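(* Every graph $G$ of stability at most two is b-continuous; that is, $G$ admits a b-coloring with exactly $t$ colors for every integer $t$ with $\chi(G) \le t \le \chi_b(G)$.
   Context: Graphs are finite and simple. The stability of a graph is the maximum cardinality of a set of pairwise non-adjacent vertices. A b-coloring of $G$ with $t$ colors is a proper coloring of the vertices with $t$ colors such that every color class contains a vertex that is adjacent to all other $t-1$ color classes. $\chi(G)$ is the chromatic number of $G$, and the b-chromatic number $\chi_b(G)$ is the maximum $t$ such that $G$ admits a b-coloring with $t$ colors. *)

(* Defs.v *)
From mathcomp Require Import all_boot.

Set Implicit Arguments.
Unset Strict Implicit.
Unset Printing Implicit Defensive.

Record sgraph := SGraph {
  vertex :> finType;
  adj : rel vertex;
  adj_sym : symmetric adj;
  adj_irrefl : irreflexive adj }.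

Definition stable_set (G : sgraph) (S : {set G}) : bool :=
  [forall x in S, forall y in S, ~~ adj x y].

Definition stability (G : sgraph) : nat :=
  \max_(S : {set G} | stable_set S) #|S|.

Definition proper_coloring (G : sgraph) (t : nat) (c : {ffun G -> 'I_t}) : bool :=
  [forall x : G, forall y : G, adj x y ==> (c x != c y)].

(* In a b-coloring every color class is nonempty, so all t colors are used. *)
Definition b_coloring (G : sgraph) (t : nat) (c : {ffun G -> 'I_t}) : bool :=
  proper_coloring c &&
  [forall i : 'I_t, exists x : G, (c x == i) &&
     [forall j : 'I_t, (j != i) ==> [exists y : G, adj x y && (c y == j)]]].

Definition colorable (G : sgraph) (t : nat) : bool :=
  [exists c : {ffun G -> 'I_t}, proper_coloring c].

Definition b_colorable (G : sgraph) (t : nat) : bool :=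
  [exists c : {ffun G -> 'I_t}, b_coloring c].

Lemma ex_colorable (G : sgraph) : exists t, colorable G t.
Proof.
exists #|G|; apply/existsP; exists [ffun x => enum_rank x].
apply/forallP => x; apply/forallP => y; apply/implyP => exy.
rewrite !ffunE (inj_eq enum_rank_inj); apply: contraTneq exy => ->.
by rewrite adj_irrefl.
Qed.

Definition chromatic_number (G : sgraph) : nat := ex_minn (ex_colorable G).

Lemma b_colorable_leq (G : sgraph) (t : nat) : b_colorable G t -> t <= #|G|.
Proof.
case/existsP => c /andP [_ /forallP bc].
have surj i : exists x, c x == i by case/existsP: (bc i) => x /andP [cx _]; exists x.
rewrite -[t in t <= _]card_ord -(card_codom (f := fun i => xchoose (surj i))).
  exact: max_card.
by apply: (can_inj (g := c)) => i; apply/eqP/(xchooseP (surj i)).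
Qed.

(* The range t <= #|G| loses nothing, by b_colorable_leq. *)
Definition b_chromatic_number (G : sgraph) : nat :=
  \max_(t < #|G|.+1 | b_colorable G t) t.

Definition b_continuous (G : sgraph) : Prop :=
  forall t : nat, chromatic_number G <= t <= b_chromatic_number G ->
    exists c : {ffun G -> 'I_t}, b_coloring c.

(* Main.v *)
(* With no stable triple, a coloring is a matching of the complement of [G]
   (color classes of size two against size one), and fewer colors means more
   edges.  Since the complement is triangle-free, the coloring is a b-coloring
   exactly when the matching has no augmenting path with one or three edges.
   Starting from such a matching [m] that is not maximum, take, among the
   matchings with one edge more, one closest to [m], say [f].  If [f] had an
   augmenting path with at most three edges, then augmenting along it would give
   [g] with two edges more than [m], on at most four further vertices.  The
   symmetric difference of [m] and [g] splits into two parts that each gain one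
   edge, so minimality of [f] forces [f] to differ from [m] on at most four
   vertices, and [m] would have a short augmenting path. *)

Require Import Defs.
From mathcomp Require Import all_boot zify.

Set Implicit Arguments.
Unset Strict Implicit.
Unset Printing Implicit Defensive.

(** * Involutions: orbits, fixed points and alternating components *)

Section Involutions.

Variable T : finType.
Implicit Types (f g m n : T -> T) (A C S : {set T}).

Definition fixset f : {set T} := [set x | f x == x].
Definition invariant_set f A := forall x, x \in A -> f x \in A.
Definition diffset f g : {set T} := [set x | f x != g x].
(** For an involution this picks one point from each orbit, so its cardinality counts orbits, which
    later are the color classes. *)
Definition reps f : {set T} := [set x | enum_rank x <= enum_rank (f x)].

Lemma in_invariant f A : involutive f -> invariant_set f A ->
  forall x, (f x \in A) = (x \in A).
Proof. by move=> fK fA x; apply/idP/idP => [/fA|/fA]; rewrite ?fK. Qed.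

Lemma invariant_setC f A : involutive f -> invariant_set f A ->
  invariant_set f (~: A).
Proof. by move=> fK fA x; rewrite !inE in_invariant. Qed.

Lemma invariant_setI f A C : invariant_set f A -> invariant_set f C ->
  invariant_set f (A :&: C).
Proof. by move=> fA fC x; rewrite !inE => /andP[/fA-> /fC->]. Qed.

(** The representatives in [A] and their images under [f] cover [A] and overlap exactly in the fixed
    points. *)
Lemma card_reps f A : involutive f -> invariant_set f A ->
  (#|A :&: reps f|).*2 = #|A| + #|A :&: fixset f|.
Proof.
move=> fK fA; pose U := A :&: reps f.
have imU : f @: U = A :&: [set x | enum_rank (f x) <= enum_rank x].
  apply/setP => x; apply/imsetP/idP => [[y]|].
    by rewrite !inE => /andP[yA yr] ->; rewrite fA // fK.
  rewrite !inE => /andP[xA xr]; exists (f x); last by rewrite fK.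
  by rewrite !inE fA // fK.
have cU : #|f @: U| = #|U| by rewrite card_imset //; apply: inv_inj.
have UU : U :|: f @: U = A.
  by rewrite imU -setIUr; apply/setP => x; rewrite !inE leq_total andbT.
have UI : U :&: f @: U = A :&: fixset f.
  rewrite imU -setIIr; congr (_ :&: _); apply/setP => x.
  by rewrite !inE -eqn_leq (inj_eq val_inj) (inj_eq enum_rank_inj) eq_sym.
by rewrite -addnn -{2}cU -cardsUI UU UI.
Qed.

(** For involutions this is the orbit of [x] under the group generated by [m] and [n]: the
    alternating path or cycle through [x] in the union of two matchings. *)
Definition component m n x : {set T} :=
  [set y | fconnect (n \o m) x y || fconnect (n \o m) x (m y)].

Section Component.

Variables m n : T -> T.
Hypotheses (mK : involutive m) (nK : involutive n).
Let p := n \o m.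

Let p_inj : injective p.
Proof. exact: inj_comp (inv_inj nK) (inv_inj mK). Qed.

Lemma component_invl x : invariant_set m (component m n x).
Proof. by move=> y; rewrite !inE mK orbC. Qed.

Lemma component_invr x : invariant_set n (component m n x).
Proof.
move=> y; rewrite !inE => /orP[xy|xy]; apply/orP; [right|left].
  rewrite (connect_trans xy) // fconnect_sym //.
  by apply: connect1; rewrite /= mK nK.
by rewrite (connect_trans xy) //; apply: connect1; rewrite /= mK.
Qed.

(* [m] conjugates [p] to its inverse, so it acts on a [p]-cycle as a
   reflection, and a reflection of a cycle fixes at most two points. *)
Lemma component_fix x : #|component m n x :&: fixset m| <= 2.
Proof.
have [->|[y]] := set_0Vmem (component m n x :&: fixset m); first by rewrite cards0.
rewrite !inE => /andP[xy0 /eqP my].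
have xy : fconnect p x y by move: xy0; rewrite my orbb.
(* If z = p^i(y) is also fixed by [m], the reflection gives p^(2i)(y) = y. As i is below the order
   of [y], 2i is 0 or that order, which leaves only [y] and the point halfway round. *)
rewrite (leq_trans (subset_leq_card (_ : _ \subset [set y; iter (order p y)./2 p y]))) //.
  2: by rewrite cards2; case: eqP.
apply/subsetP => z; rewrite !inE => /andP[xz0 /eqP mz].
have xz : fconnect p x z by move: xz0; rewrite mz orbb.
have yz : fconnect p y z by rewrite (connect_trans _ xz) // fconnect_sym.
have ltz := findex_max yz; set i := findex p y z in ltz.
have iz : iter i p y = z by apply: iter_findex.
have refl k u : iter k p (m (iter k p u)) = m u.
  elim: k u => // k IH u; rewrite iterS iterSr IH /= /p /=.
  by rewrite mK nK.
have pp : iter (i + i) p y = y by rewrite iterD iz -{1}mz -iz refl my.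
have small k : k < order p y -> iter k p y = y -> k = 0.
  by move=> lk /(congr1 (findex p y)); rewrite findex_iter // findex0.
case: (ltnP (i + i) (order p y)) => [lt|ge].
  by have i0 := small _ lt pp; rewrite -iz (_ : i = 0) ?eqxx //; lia.
have : i + i - order p y = 0.
  apply: small; first by lia.
  have : iter (i + i - order p y) p (iter (order p y) p y) = y.
    by rewrite -iterD subnK.
  by rewrite (iter_order p_inj).
by move=> e; rewrite -iz (_ : (order p y)./2 = i) ?eqxx ?orbT //; lia.
Qed.

(** Take the component of a fixed point of [m]. It has one or two fixed points of [m], and by
    [card_reps] as many of [n] modulo 2, so its surplus is either 2 or at most 0. In the second case
    the rest of [A] still has a positive surplus, and induction applies. *)
Lemma invariant_surplus A : invariant_set m A -> invariant_set n A ->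
  #|A :&: fixset n| < #|A :&: fixset m| ->
  exists C, [/\ invariant_set m C, invariant_set n C &
    #|C :&: fixset m| = #|C :&: fixset n| + 2].
Proof.
have [k] := ubnP #|A|; elim: k A => // k IH A leAk mA nA lt.
have /card_gt0P[x] : 0 < #|A :&: fixset m| by lia.
rewrite !inE => /andP[xA mx].
pose C := A :&: component m n x.
have xC : x \in C by rewrite !inE xA connect0.
have mC : invariant_set m C by apply: invariant_setI mA (@component_invl x).
have nC : invariant_set n C by apply: invariant_setI nA (@component_invr x).
have fix1 : 0 < #|C :&: fixset m| by apply/card_gt0P; exists x; rewrite inE xC inE.
have fix2 : #|C :&: fixset m| <= 2.
  apply: leq_trans (component_fix x); apply: subset_leq_card.
  by rewrite setSI // subsetIr.
have := card_reps mK mC; have := card_reps nK nC => cn cm.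
have [e|ne] := eqVneq #|C :&: fixset m| (#|C :&: fixset n| + 2); first by exists C.
have split B : #|A :&: B| = #|C :&: B| + #|(A :\: C) :&: B|.
  rewrite -(cardsID C (A :&: B)); congr (_ + _); last by rewrite setIDAC.
  by rewrite setIAC (setIidPr (subsetIl _ _)).
apply: (IH (A :\: C)).
- have := split setT; rewrite !setIT; have : 0 < #|C| by apply/card_gt0P; exists x.
  by lia.
- by rewrite setDE; apply: invariant_setI mA (invariant_setC mK mC).
- by rewrite setDE; apply: invariant_setI nA (invariant_setC nK nC).
- have := split (fixset m); have := split (fixset n); lia.
Qed.

End Component.
End Involutions.

(** * Short augmenting paths and distances between matchings *)

(* A matching of the reflexive graph [e] is encoded as an involution moving
   every vertex along [e]; its fixed points are the unmatched vertices. *)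
Section Matchings.

Variables (T : finType) (e : rel T).
Hypotheses (e_refl : reflexive e) (e_sym : symmetric e).
Implicit Types (f g m n : {ffun T -> T}) (C S : {set T}).

Definition matching f := [forall x, (f (f x) == x) && e x (f x)].

(* No augmenting path with one edge ([a = y]) or three edges. *)
Definition strongly_maximal f := forall a x y,
  f x = x -> f y = y -> x != y -> e a x -> ~~ e (f a) y.

Lemma matchingK f : matching f -> involutive f.
Proof. by move=> /forallP fM x; have /andP[/eqP] := fM x. Qed.

Lemma matching_rel f x : matching f -> e x (f x).
Proof. by move=> /forallP fM; have /andP[] := fM x. Qed.

Definition switch S f (g : T -> T) : {ffun T -> T} :=
  [ffun x => if x \in S then g x else f x].

Lemma switch_matching S f (g : T -> T) : matching f -> invariant_set f S ->
    {in S, forall x, [/\ g x \in S, g (g x) = x & e x (g x)]} ->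
  matching (switch S f g).
Proof.
move=> fM fS gS; apply/forallP => x; rewrite !ffunE; have [xS|xS] := boolP (x \in S).
  by have [-> -> ->] := gS x xS; rewrite eqxx.
rewrite (in_invariant (matchingK fM) fS) (negPf xS).
by rewrite matchingK // eqxx matching_rel.
Qed.

Lemma card_fix_switch S f (g : T -> T) :
  #|fixset (switch S f g)| + #|S :&: fixset f| = #|S :&: fixset g| + #|fixset f|.
Proof.
rewrite -(cardsID S (fixset (switch S f g))) -(cardsID S (fixset f)).
have -> : fixset (switch S f g) :&: S = S :&: fixset g.
  by apply/setP => x; rewrite !inE ffunE andbC; case: ifP.
have -> : fixset (switch S f g) :\: S = fixset f :\: S.
  by apply/setP => x; rewrite !inE ffunE; case: ifP.
by rewrite (setIC S (fixset f)); lia.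
Qed.

Lemma diff_switch S f (g : T -> T) : diffset f (switch S f g) = S :&: diffset f g.
Proof. by apply/setP => x; rewrite !inE ffunE; case: ifP => // _; rewrite eqxx. Qed.

Lemma switch_matching2 C m n : matching m -> matching n ->
  invariant_set m C -> invariant_set n C -> matching (switch C m n).
Proof.
move=> mM nM mC nC; apply: switch_matching => // x xC.
by rewrite nC // matchingK // matching_rel.
Qed.

Lemma matching_surplus m n : matching m -> matching n ->
    #|fixset n| < #|fixset m| ->
  exists C, [/\ invariant_set m C, invariant_set n C &
    #|C :&: fixset m| = #|C :&: fixset n| + 2].
Proof.
move=> mM nM lt.
by apply: (invariant_surplus (matchingK mM) (matchingK nM) (A := setT)); rewrite ?setTI.
Qed.

(** A set [C] of surplus 2 leaves surplus 2 on its complement. Switching [m] to [n] on either side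
    gains one edge, and the side with fewer differences is chosen. *)
Lemma half_distance m n : matching m -> matching n ->
    #|fixset m| = #|fixset n| + 4 ->
  exists m1, [/\ matching m1, #|fixset m| = #|fixset m1| + 2 &
    (#|diffset m m1|).*2 <= #|diffset m n|].
Proof.
move=> mM nM e4; have [|C [mC nC eC]] := matching_surplus mM nM; first by lia.
have mD := invariant_setC (matchingK mM) mC.
have nD := invariant_setC (matchingK nM) nC.
have split (B : {set T}) : #|B| = #|C :&: B| + #|~: C :&: B|.
  by rewrite -(cardsID C B) setDE setIC (setIC (~: C)).
have := split (diffset m n); have := split (fixset m); have := split (fixset n).
have := card_fix_switch C m n; have := card_fix_switch (~: C) m n => f1 f2 s1 s2 s3.
case: (leqP #|C :&: diffset m n| #|~: C :&: diffset m n|) => le.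
  exists (switch C m n); split; first exact: switch_matching2.
    by lia.
  by rewrite diff_switch; lia.
exists (switch (~: C) m n); split; first exact: switch_matching2.
  by lia.
by rewrite diff_switch; lia.
Qed.

Lemma switch_augment S f (g : T -> T) : matching f -> invariant_set f S ->
    {in S, forall x, [/\ g x \in S, g (g x) = x, e x (g x) & g x != x]} ->
    #|S :&: fixset f| = 2 -> #|S| <= 4 ->
  exists n, [/\ matching n, #|fixset f| = #|fixset n| + 2 & #|diffset f n| <= 4].
Proof.
move=> fM fS gS c2 c4; exists (switch S f g); split.
- by apply: switch_matching => // x /gS[].
- have := card_fix_switch S f g.
  have -> : S :&: fixset g = set0.
    by apply/setP => x; rewrite !inE; apply/andP => -[/gS[_ _ _ /negPf->]].
  by rewrite cards0; lia.
- by rewrite diff_switch (leq_trans _ c4) // subset_leq_card // subsetIl.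
Qed.

Lemma augment_edge f x y : matching f -> f x = x -> f y = y -> x != y -> e x y ->
  exists n, [/\ matching n, #|fixset f| = #|fixset n| + 2 & #|diffset f n| <= 4].
Proof.
move=> fM fx fy xy exy.
apply: (@switch_augment [set x; y] f (fun z => if z == x then y else x)) => //.
- by move=> z /set2P[]->; rewrite ?fx ?fy !inE eqxx ?orbT.
- have yx : (y == x) = false by rewrite eq_sym (negPf xy).
  by move=> z /set2P[]->; rewrite ?eqxx ?yx ?eqxx !inE eqxx ?orbT; split=> //;
     rewrite ?yx // e_sym.
- rewrite (_ : _ :&: _ = [set x; y]) ?cards2 ?xy //.
  by apply/setIidPl/subsetP => z /set2P[]->; rewrite inE ?fx ?fy.
- by rewrite cards2 xy.
Qed.

Lemma augment_path3 f a x y : matching f -> f x = x -> f y = y -> x != y ->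
    f a != a -> e a x -> e (f a) y ->
  exists n, [/\ matching n, #|fixset f| = #|fixset n| + 2 & #|diffset f n| <= 4].
Proof.
move=> fM fx fy xy fa eax eby; have fK := matchingK fM.
have ax : (a == x) = false by apply: contraNF fa => /eqP->; rewrite fx.
have ay : (a == y) = false by apply: contraNF fa => /eqP->; rewrite fy.
have bx : (f a == x) = false by rewrite -[x]fx (inj_eq (inv_inj fK)).
have by_ : (f a == y) = false by rewrite -[y]fy (inj_eq (inv_inj fK)).
have ba : (f a == a) = false by apply/negbTE.
have yx : (y == x) = false by rewrite eq_sym; apply/negbTE.
pose S := [set x; a; f a; y].
have SP z : z \in S -> [\/ z = x, z = a, z = f a | z = y].
  by rewrite !inE => /orP[/orP[/orP[]|]|] /eqP->; constructor.
(* The rematching along the path x, a, f a, y: [x] is paired with [a], and [f a] with [y]. *)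
pose g z := if z == x then a else if z == a then x else if z == f a then y else f a.
have gx : g x = a by rewrite /g eqxx.
have ga : g a = x by rewrite /g ax eqxx.
have gb : g (f a) = y by rewrite /g bx ba eqxx.
have gy : g y = f a by rewrite /g yx ![y == _]eq_sym ay by_.
have SE z : z \in [:: x; a; f a; y] -> z \in S by rewrite !inE -!orbA.
apply: (@switch_augment S f g) => //.
- by move=> z /SP[]->; rewrite ?fx ?fy ?fK !inE eqxx ?orbT.
- move=> z /SP[]->; rewrite ?gx ?ga ?gb ?gy; split=> //;
    rewrite ?inE ?eqxx ?orbT ?ax ?bx //.
  + by rewrite e_sym.
  + by rewrite eq_sym ax.
  + by rewrite eq_sym by_.
  + by rewrite e_sym.
  + by rewrite by_.
- rewrite (_ : _ :&: _ = [set x; y]) ?cards2 ?xy //.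
  apply/setP => z; apply/setIP/set2P => [[/SP[]->]|[]->]; rewrite ?inE ?fK ?fx ?fy ?eqxx ?orbT; auto.
    by rewrite ba.
  by rewrite eq_sym ba.
- rewrite /S -!setUA !cardsU1 cards1; lia.
Qed.

Lemma not_strongly_maximal f : matching f ->
    (forall n, matching n -> #|fixset f| = #|fixset n| + 2 ->
       #|diffset f n| <= 4 -> False) ->
  strongly_maximal f.
Proof.
move=> fM noaug a x y fx fy xy eax; apply/negP => eby.
(* If [a] is unmatched, the path degenerates to the single edge from [a] to [x], or from [x] to [y]
   when [a] is [x]. *)
have [fa|fa] := eqVneq (f a) a.
  have [n [? ? ?]] : exists n, [/\ matching n, #|fixset f| = #|fixset n| + 2
      & #|diffset f n| <= 4].
    have [ax|ax] := eqVneq a x; last exact: (augment_edge fM fa fx).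
    by move: eby; rewrite fa ax; apply: augment_edge.
  exact: (noaug n).
have [n [? ? ?]] := augment_path3 fM fx fy xy fa eax eby.
exact: (noaug n).
Qed.

(** Two vertices [x] and [y] are free in [m] but matched by [n]. Without short augmenting paths,
    [n x] and [n y] are matched by [m], and not to each other. Hence [x], [y], [n x], [m (n x)] and
    [n y] are five distinct vertices where [m] and [n] differ. *)
Lemma strongly_maximal_far m n : matching m -> matching n -> strongly_maximal m ->
  #|fixset m| = #|fixset n| + 2 -> 4 < #|diffset m n|.
Proof.
move=> mM nM strong eqf; rewrite ltnNge; apply/negP => le4.
have mK := matchingK mM; have nK := matchingK nM.
set D := diffset m n in le4 *.
have mD : invariant_set m D.
  by move=> x; rewrite !inE mK; apply: contraNneq => xE; rewrite {2}xE nK.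
have nD : invariant_set n D.
  by move=> x; rewrite !inE nK; apply: contraNneq => xE; rewrite -{1}xE mK.
have : 1 < #|fixset m :\: fixset n|.
  have := cardsID (fixset n) (fixset m).
  have : #|fixset m :&: fixset n| <= #|fixset n| by rewrite subset_leq_card ?subsetIr.
  lia.
case/card_gt1P => x [y []]; rewrite !inE => /andP[nx /eqP mx] /andP[ny /eqP my] xy.
have free_image z : m z = z -> n z != z -> m (n z) != n z.
  move=> mz nz; apply/eqP => mnz.
  have := strong (n z) z (n z) mz mnz; rewrite eq_sym nz mnz e_refl => /(_ isT).
  by rewrite e_sym matching_rel // => /(_ isT).
have mnx := free_image x mx nx; have mny := free_image y my ny.
have xD : x \in D by rewrite inE mx eq_sym.
have yD : y \in D by rewrite inE my eq_sym.
have neq z u : m z = z -> m u != u -> (z == u) = false.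
  by move=> mz; apply: contraNF => /eqP<-; rewrite mz.
have mmnx : m (m (n x)) != m (n x) by rewrite mK eq_sym.
have nxy : (n x == n y) = false by rewrite (inj_eq (inv_inj nK)) (negPf xy).
have [yb|yb] := eqVneq (n y) (m (n x)).
  have := strong (n x) x y mx my xy; rewrite e_sym matching_rel // => /(_ isT).
  by rewrite -yb e_sym matching_rel.
have : #|[set x; y; n x; m (n x); n y]| <= #|D|.
  apply: subset_leq_card.
  by rewrite !subUset !sub1set xD yD (nD _ xD) (mD _ (nD _ xD)) (nD _ yD).
rewrite -!setUA !cardsU1 cards1 !inE (negPf xy) !(neq x) // !(neq y) //.
rewrite nxy eq_sym (negPf mnx) eq_sym (negPf yb) /=; lia.
Qed.

Theorem augment_strongly_maximal m n : matching m -> matching n ->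
    strongly_maximal m -> #|fixset n| < #|fixset m| ->
  exists m1, [/\ matching m1, strongly_maximal m1 & #|fixset m| = #|fixset m1| + 2].
Proof.
move=> mM nM strong lt.
pose P f := matching f && (#|fixset m| == #|fixset f| + 2).
have [f0 Pf0] : exists f, P f.
  have [C [mC nC eC]] := matching_surplus mM nM lt.
  exists (switch C m n); rewrite /P switch_matching2 //=.
  have := card_fix_switch C m n; lia.
have [f /andP[fM /eqP ff] fmin] := arg_minnP (fun f : {ffun T -> T} => #|diffset m f|) Pf0.
exists f; split=> //; apply: not_strongly_maximal => // g gM fg d4.
have [|h [hM mh dh]] := half_distance mM gM; first by lia.
have Ph : P h by rewrite /P hM mh eqxx.
have := fmin h Ph; have := strongly_maximal_far mM fM strong ff.
(* With d the number of differences, 2 d(m,f) <= 2 d(m,h) <= d(m,g) <= d(m,f) + 4. So d(m,f) <= 4,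
   against [strongly_maximal_far]. *)
have : #|diffset m g| <= #|diffset m f| + #|diffset f g|.
  apply: leq_trans (leq_card_setU _ _).
  apply: subset_leq_card; apply/subsetP => z; rewrite !inE -negb_and.
  by apply: contra => /andP[/eqP-> /eqP->].
lia.
Qed.

End Matchings.

(** * Colorings as matchings of the complement *)

Section Colorings.

Variable G : sgraph.
Hypothesis stabG : stability G <= 2.

Local Notation e := [rel x y : G | ~~ adj x y].

Let e_refl : reflexive e.
Proof. by move=> x; rewrite /= adj_irrefl. Qed.

Let e_sym : symmetric e.
Proof. by move=> x y; rewrite /= adj_sym. Qed.

Lemma no_stable_triple (x y z : G) : x != y -> x != z -> y != z ->
  ~~ adj x y -> ~~ adj x z -> adj y z.
Proof.
move=> xy xz yz nxy nxz; apply: contraLR stabG => nyz; rewrite -ltnNge.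
have -> : 3 = #|[set x; y; z]|.
  by rewrite -setUA !cardsU1 cards1 !inE negb_or xy xz yz.
apply: (@leq_bigmax_cond _ (@stable_set G) (fun S => #|S|)).
apply/forallP => u; apply/implyP; rewrite !inE -orbA => uS.
apply/forallP => v; apply/implyP; rewrite !inE -orbA => vS.
by case/or3P: uS => /eqP->; case/or3P: vS => /eqP->;
  rewrite ?adj_irrefl // adj_sym.
Qed.

Lemma coloring_matching t (c : {ffun G -> 'I_t}) : proper_coloring c ->
  exists f : {ffun G -> G},
    matching e f /\ forall x y, (c x == c y) = (y == x) || (y == f x).
Proof.
move=> /forallP pc.
have nadj x y : c x = c y -> ~~ adj x y.
  by move=> cxy; have /forallP/(_ y) := pc x; rewrite cxy eqxx implybF.
pose P x := [pred y | (y != x) && (c x == c y)].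
(* The default [x] makes singleton classes the fixed points of [f]. *)
pose f : {ffun G -> G} := [ffun x => odflt x [pick y | P x y]].
have fc x : c (f x) = c x by rewrite ffunE; case: pickP => //= y /andP[_ /eqP].
have cf x y : (c x == c y) = (y == x) || (y == f x).
  apply/idP/orP => [/eqP cxy|[]/eqP-> //]; last by rewrite fc.
  have [yx|yx] := eqVneq y x; [by left|right].
  rewrite ffunE; case: pickP => [z /andP[zx /eqP cxz]|/(_ y)] /=; last first.
    by rewrite yx cxy eqxx.
  apply/negPn/negP => yz.
  have := @no_stable_triple x y z; rewrite ![x == _]eq_sym => /(_ yx zx yz).
  rewrite !nadj // => /(_ isT isT) ayz.
  by have := nadj y z; rewrite ayz -cxy -cxz => /(_ erefl).
exists f; split=> //; apply/forallP => x; rewrite /= nadj // andbT.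
have := cf (f x) x; rewrite fc eqxx => /esym/orP[] /eqP xE; last by rewrite -xE.
by rewrite -!xE.
Qed.

Section Classes.

Variables (t : nat) (c : {ffun G -> 'I_t}) (f : {ffun G -> G}).
Hypotheses (fM : matching e f)
  (cf : forall x y, (c x == c y) = (y == x) || (y == f x)).

Lemma class_swap x : c (f x) = c x.
Proof. by apply/eqP; rewrite eq_sym cf eqxx orbT. Qed.

Lemma color_inj_reps : {in reps f &, injective c}.
Proof.
move=> x y; rewrite !inE => xr yr /eqP; rewrite cf => /orP[/eqP//|/eqP yE].
apply/enum_rank_inj/val_inj/eqP; rewrite eqn_leq /= {1}yE xr.
by move: yr; rewrite {2}yE (matchingK fM).
Qed.

Lemma leq_card_reps_colors : #|reps f| <= t.
Proof. by rewrite -(card_in_imset color_inj_reps) -[t in _ <= t]card_ord max_card. Qed.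

Lemma card_reps_colors : (forall i, exists x, c x = i) -> #|reps f| = t.
Proof.
move=> surj; rewrite -(card_in_imset color_inj_reps) -[RHS]card_ord.
rewrite (_ : c @: _ = setT) ?cardsT //; apply/setP => i; rewrite inE.
have [x <-] := surj i; apply/imsetP.
have [xr|xr] := boolP (x \in reps f); first by exists x.
exists (f x); rewrite ?class_swap // inE (matchingK fM).
by move: xr; rewrite inE -ltnNge => /ltnW.
Qed.

(** A fixed point is a whole color class, so every b-vertex is adjacent to all fixed points of other
    colors. The b-vertex in the class of [a] is [a] or [f a], and the two non-adjacencies of an
    augmenting path contradict this in either case. *)
Lemma b_coloring_strongly_maximal : b_coloring c -> strongly_maximal e f.
Proof.
case/andP => _ /forallP bc a x y fx fy xy /= nax; apply/negP => nby.
have single v p : (forall j, j != c v -> exists2 w, adj v w & c w = j) ->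
    f p = p -> c p != c v -> adj v p.
  move=> bv fp cpv; have [w avw /esym/eqP] := bv _ cpv.
  by rewrite cf fp orbb => /eqP <-.
have cxy : c x != c y by rewrite cf fx orbb eq_sym.
have /existsP[v /andP[/eqP cv /forallP bv']] := bc (c a).
have {}bv' j : j != c v -> exists2 w, adj v w & c w = j.
  move: (bv' j) => /implyP; rewrite cv => h /h /existsP[w /andP[avw /eqP]].
  by exists w.
have bv p := single v p bv'; rewrite cv in bv.
have /orP[/eqP va|/eqP va] : (v == a) || (v == f a) by rewrite -cf cv.
- have [/eqP|cax] := eqVneq (c x) (c a); last by rewrite -va bv in nax.
  rewrite cf fx orbb => /eqP ax; move: (bv y fy).
  rewrite ax eq_sym => /(_ cxy); rewrite va ax.
  by move: nby; rewrite ax fx => /negPf->.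
- have [/eqP|cay] := eqVneq (c y) (c a); last by rewrite -va bv in nby.
  rewrite cf fy orbb => /eqP ay; move: (bv x fx).
  rewrite ay => /(_ cxy); rewrite va ay fy.
  by move: nax; rewrite ay => /negPf->.
Qed.

Lemma strongly_maximal_b_coloring : (forall i, exists x, c x = i) ->
  strongly_maximal e f -> b_coloring c.
Proof.
move=> surj strong; apply/andP; split.
  apply/forallP => x; apply/forallP => y; apply/implyP; apply: contraTneq => /eqP.
  rewrite cf => /orP[]/eqP->; first by rewrite adj_irrefl.
  exact: (matching_rel _ fM).
apply/forallP => i; have [x cx] := surj i.
(* First only singleton classes are considered. If [x] misses one, [p], then [f x] serves: missing
   another one [q] would give the augmenting path p, x, f x, q, and missing [p] as well would give a
   stable triple, or a single augmenting edge when [f x] is [x]. *)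
have [v cv vP] : exists2 v, c v = i & forall p, f p = p -> c p != i -> adj v p.
  have [/existsP[p /and3P[/eqP fp cp nxp]]|] :=
      boolP [exists p, [&& f p == p, c p != i & ~~ adj x p]].
    exists (f x); first by rewrite class_swap.
    move=> q fq cq; apply/negPn/negP => nq.
    have [pq|pq] := eqVneq p q; last first.
      by have := strong x p q fp fq pq nxp; rewrite /= nq.
    rewrite -{q fq}pq in cq nq.
    have xp : x != p by apply: contraNneq cp => <-; rewrite cx.
    have fxp : f x != p by apply: contraNneq cp => <-; rewrite class_swap cx.
    have [fx|fx] := eqVneq (f x) x.
      have := strong p x p fx fp xp.
      by rewrite /= adj_sym fp adj_irrefl => /(_ nxp).
    have := @no_stable_triple x (f x) p; rewrite eq_sym fx xp fxp nxp (negPf nq).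
    by have := matching_rel x fM; rewrite /= => -> /(_ isT isT isT isT isT).
  rewrite negb_exists => /forallP noP; exists x => // p fp cp.
  by have := noP p; rewrite fp eqxx cp /= negbK.
apply/existsP; exists v; rewrite cv eqxx; apply/forallP => j; apply/implyP => ji.
have [y cy] := surj j; apply/existsP.
have vy w : c w = j -> v != w by move=> cw; apply: contraNneq ji => vw; rewrite -cw -vw cv.
have [fy|fy] := eqVneq (f y) y.
  by exists y; rewrite vP ?cy ?eqxx.
(* A class of two vertices cannot be missed entirely by [v], since the three vertices would form a
   stable triple. *)
have [avy|navy] := boolP (adj v y); first by exists y; rewrite avy cy eqxx.
exists (f y); rewrite class_swap cy eqxx andbT; apply/negPn/negP => navfy.
have := @no_stable_triple v y (f y); rewrite !vy ?class_swap // eq_sym fy navy navfy.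
by have := matching_rel y fM; rewrite /= => /negPf-> /(_ isT isT isT isT isT).
Qed.

End Classes.

Lemma matching_coloring (f : {ffun G -> G}) : matching e f ->
  exists c : {ffun G -> 'I_#|reps f|}, (forall i, exists x, c x = i) /\
    forall x y, (c x == c y) = (y == x) || (y == f x).
Proof.
move=> fM; have fK := matchingK fM.
(* Each vertex is colored by the representative of its orbit. *)
pose rep x := if x \in reps f then x else f x.
have repP x : rep x \in reps f.
  rewrite /rep; case: ifPn => //; rewrite !inE fK -ltnNge; exact: ltnW.
pose c : {ffun G -> 'I_#|reps f|} := [ffun x => enum_rank_in (repP x) (rep x)].
have cK x : enum_val (c x) = rep x by rewrite ffunE enum_rankK_in.
have crep x y : (c x == c y) = (rep x == rep y).
  by rewrite -(inj_eq enum_val_inj) !cK.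
have repf x : rep (f x) = rep x.
  rewrite /rep !inE fK; case: ltngtP => // /val_inj/enum_rank_inj.
  by [].
exists c; split=> [i|x y].
  exists (enum_val i); apply: enum_val_inj; rewrite cK /rep.
  by rewrite enum_valP.
rewrite crep; apply/idP/orP => [|[]/eqP-> //]; last by rewrite repf.
have repE z : rep z = z \/ rep z = f z by rewrite /rep; case: ifP; auto.
move=> /eqP; case: (repE x) => ->; case: (repE y) => -> E.
- by left; rewrite E.
- by right; rewrite E fK.
- by right; rewrite E.
- by left; rewrite (inv_inj fK E).
Qed.

Lemma b_colorable_surj t (c : {ffun G -> 'I_t}) : b_coloring c ->
  forall i, exists x, c x = i.
Proof.
by case/andP => _ /forallP bc i; have /existsP[x /andP[/eqP]] := bc i; exists x.
Qed.

(** By [card_reps], twice the number of classes is the order of [G] plus the number of fixed points.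
    The coloring with [s] colors thus gives a matching with fewer fixed points than that of the
    b-coloring, and removing two fixed points removes one color. *)
Lemma b_colorable_step s t : colorable G s -> s <= t -> b_colorable G t.+1 ->
  b_colorable G t.
Proof.
move=> /existsP[d pd] st /existsP[c bc]; have surj := b_colorable_surj bc.
have [n [nM dn]] := coloring_matching pd.
have [|m [mM cm]] := @coloring_matching _ c; first by case/andP: bc.
have strong := b_coloring_strongly_maximal cm bc.
have rm := card_reps_colors mM cm surj.
have rn := leq_card_reps_colors nM dn.
have cardG f : matching e f -> (#|reps f|).*2 = #|G| + #|fixset f|.
  move=> fM; have := @card_reps _ f setT (matchingK fM).
  by rewrite !setTI cardsT; apply=> x; rewrite inE.
have cGm := cardG m mM; have cGn := cardG n nM.
have [|m1 [m1M strong1 fix1]] := augment_strongly_maximal e_refl e_sym mM nM strong.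
  lia.
have -> : t = #|reps m1| by have := cardG m1 m1M; lia.
have [c1 [surj1 c1m]] := matching_coloring m1M.
by apply/existsP; exists c1; apply: strongly_maximal_b_coloring m1M c1m surj1 strong1.
Qed.

End Colorings.

Theorem theorem4 (G : sgraph) : stability G <= 2 -> b_continuous G.
Proof.
move=> stabG t /andP[chit tb]; apply/existsP.
have [s Gs st] : exists2 s, colorable G s & s <= t.
  by exists (chromatic_number G) => //; rewrite /chromatic_number; case: ex_minnP.
(* An empty maximum is 0, so a b-coloring with at least [t] colors can be extracted from
   [b_chromatic_number] only for positive [t]. For t = 0 there is no color class to check. *)
have [t0|tpos] := posnP t.
  move: Gs; rewrite -(_ : t = s); last by lia.
  case/existsP => c pc; apply/existsP; exists c; rewrite /b_coloring pc.
  by apply/forallP => i; have := ltn_ord i; rewrite {2}t0.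
have [u Gu tu] : exists2 u, b_colorable G u & t <= u.
  have : ~~ (b_chromatic_number G <= t.-1) by lia.
  move=> h; have /existsP[i /andP[Gi ti]] :
      [exists i : 'I_#|G|.+1, b_colorable G i && (t <= i)].
    apply: contraR h; rewrite negb_exists => /forallP h.
    by apply/bigmax_leqP => i Gi; have := h i; rewrite Gi /=; lia.
  by exists i.
(* Descent from [u] to [t], one color at a time. *)
rewrite -(subnK tu) in Gu; elim: (u - t) Gu => [//|k IH] Gk; apply: IH.
by apply: (b_colorable_step stabG Gs _ Gk); apply: leq_trans st (leq_addl k t).
Qed.
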